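(* Let $\mathcal{H}$ be a real Hilbert space, $Q\subset\mathcal{H}$ a nonempty, closed and convex subset, $S:Q\to Q$ a nonexpansive mapping, $A:Q\to\mathcal{H}$ a $\nu$-inverse strongly monotone operator with $\nu>0$, and $f:Q\to Q$ a contraction with coefficient $\rho\in[0,1[$. Assume that $\Omega:=F_{ix}(S)\cap S_{VI(A,Q)}$ is nonempty. Let $a$ and $b$ be two reals such that $0<a<b<2\nu$ and let $\lambda:]0,1[\to[a,b]$ be a mapping. Then, for every $t\in]0,1[$, there exists a unique $x_t\in Q$ such that $$x_t=t f(x_t)+(1-t)SP_Q(x_t-\lambda(t)Ax_t).$$ Moreover, $x_t$ converges strongly in $\mathcal{H}$ as $t\to0^+$ to $q^*$, the unique solution of the variational problem (VP): $q^*\in\Omega$ and $\langle f(q^* )-q^*,x-q^*\rangle\le0$ for all $x\in\Omega$.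
   Context: $\mathcal{H}$ has inner product $\langle\cdot,\cdot\rangle$ and associated norm $\|\cdot\|$. Nonexpansive: $\|Sx-Sy\|\le\|x-y\|$ for all $x,y\in Q$. $\nu$-inverse strongly monotone: $\langle Ax-Ay,x-y\rangle\ge\nu\|Ax-Ay\|^2$ for all $x,y\in Q$. Contraction with coefficient $\rho$: $\|f(x)-f(y)\|\le\rho\|x-y\|$ for all $x,y\in Q$. $F_{ix}(S)=\{x\in Q: Sx=x\}$. $S_{VI(A,Q)}=\{q\in Q:\langle Aq,x-q\rangle\ge0\ \text{for every }x\in Q\}$. $P_Q:\mathcal{H}\to Q$ is the metric projection onto $Q$. Intervals: $]0,1[$ is open, $[0,1[$ is half-open. *)

(* Defs.v *)
From HB Require Import structures.
From mathcomp Require Import all_boot all_order all_algebra.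
From mathcomp Require Import all_classical all_reals all_analysis.

Set Implicit Arguments.
Unset Strict Implicit.
Unset Printing Implicit Defensive.

Import Order.TTheory GRing.Theory Num.Theory.
Import numFieldNormedType.Exports.

Local Open Scope classical_set_scope.
Local Open Scope ring_scope.

(* A real Hilbert space is a complete normed module H over R together with a
   symmetric positive definite bilinear form (with [theta := idfun], the
   library's [dot] forms are exactly these) satisfying [induces_norm].
   A map defined on Q is represented by a total function of which only the
   values on Q are constrained and used. *)

Definition induces_norm (R : realType) (H : completeNormedModType R)
    (inner : {dot H for idfun}) : Prop :=
  forall x : H, `|x| = Num.sqrt (inner x x).

Definition nonexpansive (R : realType) (H : completeNormedModType R)
    (Q : set H) (S : H -> H) : Prop :=
  forall x y : H, Q x -> Q y -> `|S x - S y| <= `|x - y|.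

Definition inverse_strongly_monotone (R : realType)
    (H : completeNormedModType R) (inner : {dot H for idfun})
    (Q : set H) (nu : R) (A : H -> H) : Prop :=
  forall x y : H, Q x -> Q y ->
    nu * `|A x - A y| ^+ 2 <= inner (A x - A y) (x - y).

Definition fixed_points (R : realType) (H : completeNormedModType R)
    (Q : set H) (S : H -> H) : set H :=
  [set x | Q x /\ S x = x].

Definition VI_solutions (R : realType) (H : completeNormedModType R)
    (inner : {dot H for idfun}) (A : H -> H) (Q : set H) : set H :=
  [set q | Q q /\ forall x : H, Q x -> 0 <= inner (A q) (x - q)].

(* The default value 0 of [xget] is only taken when x has no nearest point
   in Q; for Q nonempty, closed and convex in a Hilbert space the nearest
   point exists and is unique. *)
Definition metric_projection (R : realType) (H : completeNormedModType R)
    (Q : set H) (x : H) : H :=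
  xget 0 [set p | Q p /\ forall y : H, Q y -> `|x - p| <= `|x - y|].

Definition VP_solution (R : realType) (H : completeNormedModType R)
    (inner : {dot H for idfun}) (Omega : set H) (f : H -> H) (q : H) : Prop :=
  Omega q /\ forall x : H, Omega x -> inner (f q - q) (x - q) <= 0.

Definition implicit_solution (R : realType) (H : completeNormedModType R)
    (Q : set H) (S A f : H -> H) (lambda : R -> R) (t : R) (x : H) : Prop :=
  Q x /\
  x = t *: f x + (1 - t) *: S (metric_projection Q (x - lambda t *: A x)).

(* Main.v *)
Require Import Defs.
From mathcomp Require Import all_boot all_order all_algebra.
From mathcomp Require Import all_classical all_reals all_analysis.
From mathcomp Require Import ring lra.

Set Implicit Arguments.
Unset Strict Implicit.
Unset Printing Implicit Defensive.

Import Order.TTheory GRing.Theory Num.Theory.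
Import numFieldNormedType.Exports.

Local Open Scope classical_set_scope.
Local Open Scope ring_scope.

(** The first claim is the contraction principle: the forward-backward step
    [T_lam x = S (P_Q (x - lam A x))] is nonexpansive on [Q] for
    [0 < lam < 2 nu], so [x |-> t f x + (1 - t) T_lam x] contracts [Q] with
    factor [t rho + 1 - t < 1].

    For the second claim, the solutions of (VP) are the fixed points of
    [P_Omega o f], where [P_Omega] is the projection onto [Omega]; this map is
    a contraction of [Q], which gives a unique [q]. From the equation of [x_t]
    and the nonexpansiveness of [T_lam] one obtains directly
    [(1 - rho) |x_t - q|^2 <= <f q - q, x_t - q>] (viscosity_inequality), so it
    remains to bound the right-hand side asymptotically by [0].

    That step is usually done by weak compactness and the demiclosedness
    principle. Here a strongly convergent curve replaces weak limits. Fix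
    [W = T_a], whose fixed points are exactly [Omega]. For [u] in [Q] let
    [y_n] solve [y - W y = (u - y) / (n + 1)]. Because [I - W] is monotone,
    [n < m] implies [|y_m - y_n|^2 <= |y_m - u|^2 - |y_n - u|^2], while
    [|y_n - u|] stays bounded; hence [y_n] is Cauchy, and its limit [p] is a
    fixed point of [W]. Monotonicity tested against an arbitrary [x] in [Q]
    reads [<u - y_n, x - y_n> <= (n + 1) |x - W x| |x - y_n|]. Fixing [n] large
    and then letting [|x - W x|] tend to [0] shows that [<u - p, x - p>] is
    asymptotically nonpositive along bounded approximate fixed points of [W]
    (projection_fixed_points). With [x] an exact fixed point this says that
    [p] is the projection of [u] onto [Omega], so the existence of [P_Omega] is
    obtained at the same time.

    Finally [x_t] is a bounded family of approximate fixed points of [W]: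
    [|x_t - T_lam(t) x_t| = O(t)] from its equation, and
    step_asymptotically_regular transfers this from the varying step
    [T_lam(t)] to the fixed step [T_a]. *)

(** * Inner products and norms *)

Section InnerProduct.
Context (R : realType) (H : completeNormedModType R).
Context (inner : {dot H for idfun}) (inner_norm : induces_norm inner).

Local Notation "''[' u , v ]" := (inner u v).

Lemma innerC u v : '[u, v] = '[v, u].
Proof. by rewrite [LHS]hermC expr0 mul1r. Qed.

Lemma innerDl u v w : '[u + v, w] = '[u, w] + '[v, w].
Proof. exact: linearDl. Qed.

Lemma innerDr u v w : '[w, u + v] = '[w, u] + '[w, v].
Proof. exact: linearDr. Qed.

Lemma innerNl u w : '[- u, w] = - '[u, w].
Proof. exact: linearNl. Qed.

Lemma innerNr u w : '[w, - u] = - '[w, u].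
Proof. exact: linearNr. Qed.

Lemma innerZl k u w : '[k *: u, w] = k * '[u, w].
Proof. exact: linearZl_LR. Qed.

Lemma innerZr k u w : '[w, k *: u] = k * '[w, u].
Proof. exact: linearZr_LR. Qed.

Definition innerE := (innerDl, innerDr, innerNl, innerNr, innerZl, innerZr).

Lemma inner_ge0 u : 0 <= '[u, u].
Proof.
have [->|u0] := eqVneq u 0; last exact/ltW/neq0_dnorm_gt0.
by rewrite -(scale0r (0 : H)) innerZl mul0r.
Qed.

Lemma normsqE u : `|u| ^+ 2 = '[u, u].
Proof. by rewrite inner_norm sqr_sqrtr// inner_ge0. Qed.

Lemma normsqB u v : `|u - v| ^+ 2 = `|u| ^+ 2 - 2 * '[u, v] + `|v| ^+ 2.
Proof. by rewrite !normsqE !innerE (innerC v u); ring. Qed.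

Lemma normsqD u v : `|u + v| ^+ 2 = `|u| ^+ 2 + 2 * '[u, v] + `|v| ^+ 2.
Proof. by rewrite !normsqE !innerE (innerC v u); ring. Qed.

(** Cauchy-Schwarz, from the positivity of the square of [|v| u - |u| v]. *)
Lemma inner_le_norm u v : '[u, v] <= `|u| * `|v|.
Proof.
have [->|u0] := eqVneq u 0.
  by rewrite -(scale0r (0 : H)) innerZl mul0r scale0r normr0 mul0r.
have [->|v0] := eqVneq v 0.
  by rewrite -(scale0r (0 : H)) innerZr mul0r scale0r normr0 mulr0.
have uv : 0 < `|u| * `|v| by rewrite mulr_gt0// normr_gt0.
have := inner_ge0 (`|v| *: u - `|u| *: v).
rewrite !innerE (innerC v u) -!normsqE => h.
rewrite -(ler_pM2l uv); nra.
Qed.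

(** The form in which nonexpansiveness of projections and the bound on the
    resolvent curve come out of variational inequalities. *)
Lemma le_norm_of_sq u v : '[u, u] <= '[u, v] -> `|u| <= `|v|.
Proof.
move=> uv; have := le_trans uv (inner_le_norm u v).
rewrite -normsqE expr2; have [->|u0] := eqVneq u 0; first by rewrite normr0.
by rewrite ler_pM2l// normr_gt0.
Qed.

End InnerProduct.

Arguments innerC {R H inner} u v.
Arguments innerDl {R H inner} u v w.
Arguments innerDr {R H inner} u v w.
Arguments innerNl {R H inner} u w.
Arguments innerNr {R H inner} u w.
Arguments innerZl {R H inner} k u w.
Arguments innerZr {R H inner} k u w.
Arguments innerE {R H inner}.

(** * Convergence, convexity and the contraction principle *)

(** One Cauchy criterion for two uses: minimizing sequences, by the
    parallelogram law, and curves whose squared increments telescope. *)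
Lemma cvgn_of_sqdist (R : realType) (H : completeNormedModType R)
    (u : nat -> H) (e : nat -> R) :
  e n @[n --> \oo] --> (0 : R) ->
  (forall n m, `|u n - u m| ^+ 2 <= e n + e m) -> cvgn u.
Proof.
move=> e0 ue; apply/cauchy_cvgP/cauchy_exP => _/posnumP[d].
have d2 : 0 < d%:num ^+ 2 / 2 by rewrite divr_gt0// exprn_gt0.
move/cvgrPdist_lt : e0 => /(_ _ d2)[N _ eN]; exists (u N).
exists N => // n /= Nn; rewrite -ball_normE /=.
rewrite -(@ltr_pXn2r _ 2)// ?nnegrE// (le_lt_trans (ue _ _))//.
have := eN _ Nn; have := eN _ (leqnn N); rewrite /= !sub0r !normrN.
by have := ler_norm (e n); have := ler_norm (e N); lra.
Qed.

Lemma convex_comb (R : realType) (H : completeNormedModType R) (Q : set H)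
    (x y : H) (t : R) :
  convex_set Q -> 0 <= t <= 1 -> Q x -> Q y -> Q (t *: x + (1 - t) *: y).
Proof.
move=> Qconvex /andP[t0 t1] /mem_set Qx /mem_set Qy.
by have := Qconvex x y (Itv01 t0 t1) Qx Qy; rewrite inE.
Qed.

Lemma contraction_unique_fixpoint (R : realType) (H : completeNormedModType R)
    (Q : set H) (T : H -> H) (k : R) :
  Q !=set0 -> closed Q -> (forall x, Q x -> Q (T x)) -> 0 <= k < 1 ->
  (forall x y, Q x -> Q y -> `|T x - T y| <= k * `|x - y|) ->
  exists! x, Q x /\ x = T x.
Proof.
move=> Q0 Qclosed TQ /andP[k0 k1] Tk.
have [p Qp pE] : exists2 p, Q p & p = mkfun TQ p.
  apply: banach_fixed_point => //; exists (NngNum k0); split=> //=.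
  by move=> [x y] /= [Qx Qy]; exact: Tk.
exists p; split=> // y [Qy yE]; apply/eqP; rewrite -subr_eq0 -normr_le0.
by have := Tk _ _ Qp Qy; rewrite -[in T p]/(mkfun TQ p) -pE -yE; nra.
Qed.

(** * Projections *)

Section Projection.
Context (R : realType) (H : completeNormedModType R).
Context (inner : {dot H for idfun}) (inner_norm : induces_norm inner).

Local Notation "''[' u , v ]" := (inner u v).

(** The obtuse-angle description of the projection of [x] onto [C]. It is used
    instead of distance minimization because it is unique and nonexpansive for
    any [C], so it applies to fixed point sets without first proving them
    convex; moreover [VP_solution inner Omega f q] is, up to conversion,
    [vi_projection Omega (f q) q]. *)
Definition vi_projection (C : set H) (x p : H) : Prop :=
  C p /\ forall y, C y -> '[x - p, y - p] <= 0.

Lemma vi_projection_nonexpansive (C : set H) (x x' p p' : H) :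
  vi_projection C x p -> vi_projection C x' p' -> `|p - p'| <= `|x - x'|.
Proof.
move=> [Cp px] [Cp' px'] ; apply: (le_norm_of_sq inner_norm).
have := px _ Cp'; have := px' _ Cp.
rewrite !innerE (innerC p' p) (innerC p x).
rewrite (innerC p' x) (innerC p x') (innerC p' x'); lra.
Qed.

Lemma vi_projection_inj (C : set H) (x p p' : H) :
  vi_projection C x p -> vi_projection C x p' -> p = p'.
Proof.
move=> px px'; apply/eqP; rewrite -subr_eq0 -normr_le0.
by have := vi_projection_nonexpansive px px'; rewrite subrr normr0.
Qed.

(** If the angle at [p] towards [y] were acute, moving from [p] towards [y] by
    a small [t] would decrease the distance to [x]: the first order gain
    [2 t c] beats the second order loss [t^2 |y - p|^2]. *)
Lemma nearest_vi_projection (Q : set H) (x p : H) : convex_set Q ->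
  Q p -> (forall y, Q y -> `|x - p| <= `|x - y|) -> vi_projection Q x p.
Proof.
move=> Qconvex Qp xp; split=> // y Qy; rewrite leNgt; apply/negP => pos.
have yp : 0 < `|y - p| ^+ 2.
  rewrite exprn_gt0// normr_gt0; apply: contraTN pos => /eqP ->.
  by rewrite -(scale0r (0 : H)) innerZr mul0r ltxx.
(* the step that minimizes the distance along the segment, capped at [y] *)
pose c := '[x - p, y - p]; pose t := Num.min 1 (c / `|y - p| ^+ 2).
have t0 : 0 < t by rewrite lt_min ltr01 divr_gt0.
have t1 : t <= 1 by rewrite ge_min lexx.
have tc : t * `|y - p| ^+ 2 <= c by rewrite -ler_pdivlMr// ge_min lexx orbT.
have := xp _ (convex_comb Qconvex (t := t) _ Qy Qp).
rewrite (ltW t0) t1 => /(_ isT).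
have -> : x - (t *: y + (1 - t) *: p) = (x - p) - t *: (y - p).
  by rewrite scalerBl scale1r scalerBr addrCA opprD addrA.
rewrite -ler_sqr ?nnegrE// (normsqB inner_norm (x - p)) innerZr.
rewrite normrZ exprMn gtr0_norm// -/c => le_c.
have : 0 < t * c by rewrite mulr_gt0.
by have := ler_wpM2l (ltW t0) tc; rewrite mulrA -expr2; clearbody c; lra.
Qed.

(** A minimizing sequence is Cauchy because, [Q] being convex, the midpoint of
    two almost minimizers is no closer to [x] than the infimum. *)
Lemma nearest_point_exists (Q : set H) (x : H) :
  Q !=set0 -> closed Q -> convex_set Q ->
  exists p, Q p /\ forall y, Q y -> `|x - p| <= `|x - y|.
Proof.
move=> [z Qz] Qclosed Qconvex; pose E := [set `|x - y| ^+ 2 | y in Q].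
have Einf : has_inf E.
  by split; [exists (`|x - z| ^+ 2), z | exists 0 => _ [y _ <-]].
have Dle y : Q y -> inf E <= `|x - y| ^+ 2.
  by move=> Qy; apply: ge_inf; [exact: Einf.2 | exists y].
have /choice[p pP] n : exists p, Q p /\ `|x - p| ^+ 2 <= inf E + harmonic n.
  have [_ [p Qp <-] lt_p] := inf_adherent (harmonic_gt0 n) Einf.
  by exists p; split=> //; exact: ltW.
have cvgp : cvgn p.
  have e0 : 2 * harmonic n @[n --> \oo] --> (0 : R).
    by rewrite -[X in _ --> X](mulr0 2); apply: cvgMr; exact: cvg_harmonic.
  apply: (cvgn_of_sqdist e0).
  move=> n m; have [Qn xn] := pP n; have [Qm xm] := pP m.
  have half : 0 <= (2^-1 : R) <= 1 by lra.
  have := Dle _ (convex_comb Qconvex half Qn Qm).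
  have hh : 2^-1 + 2^-1 = 1 :> R by field.
  have h1 : 1 - 2^-1 = 2^-1 :> R by field.
  have -> : x - (2^-1 *: p n + (1 - 2^-1) *: p m)
          = 2^-1 *: ((x - p n) + (x - p m)).
    rewrite h1 -scalerDr addrACA -opprD scalerBr.
    by rewrite [2^-1 *: (x + x)]scalerDr -scalerDl hh scale1r.
  have -> : p n - p m = (x - p m) - (x - p n).
    by rewrite opprB [RHS]addrC subrKA.
  rewrite normrZ exprMn (normsqD inner_norm) (normsqB inner_norm (x - p m)).
  rewrite (innerC (x - p n)).
  have -> : `|2^-1 : R| ^+ 2 = 4^-1 by rewrite gtr0_norm//; field.
  move: xn xm => /=; move: (n.+1%:R^-1) (m.+1%:R^-1) => k l xn xm Dmid.
  lra.
have Qlim : Q (limn p).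
  by apply: (closed_cvg _ Qclosed _ _ cvgp); near=> n; have [] := pP n.
exists (limn p); split=> // y Qy; rewrite -ler_sqr ?nnegrE//.
apply: (@ler_cvg_to _ (\oo : set_system nat) _ _ (fun n => `|x - p n| ^+ 2)
                    (fun n => `|x - y| ^+ 2 + harmonic n)).
- rewrite !expr2; apply: cvgM; apply: cvg_norm; exact: (cvgB (cvg_cst _) cvgp).
- rewrite -[X in _ --> X]addr0.
  by apply: cvgD; [exact: cvg_cst|exact: cvg_harmonic].
- near=> n; have [_ /le_trans -> //] := pP n; rewrite lerD2r; exact: Dle.
Unshelve. all: by end_near. Qed.

Lemma metric_projectionP (Q : set H) (x : H) :
  Q !=set0 -> closed Q -> convex_set Q ->
  vi_projection Q x (metric_projection Q x).
Proof.
move=> Q0 Qclosed Qconvex; rewrite /metric_projection; case: xgetP.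
  by move=> p _ [Qp xp]; exact: nearest_vi_projection.
have [p pP] := @nearest_point_exists Q x Q0 Qclosed Qconvex.
by move=> /(_ p).
Qed.

End Projection.

(** * The resolvent curve of a nonexpansive map *)

Section Resolvent.
Context (R : realType) (H : completeNormedModType R).
Context (inner : {dot H for idfun}) (inner_norm : induces_norm inner).
Context (Q : set H) (W : H -> H) (WQ : forall x, Q x -> Q (W x)).
Context (W_nonexpansive : nonexpansive Q W).

Local Notation "''[' u , v ]" := (inner u v).

(** [I - W] is monotone when [W] is nonexpansive. *)
Lemma displacement_monotone x y : Q x -> Q y ->
  0 <= '[(x - W x) - (y - W y), x - y].
Proof.
move=> Qx Qy.
have -> : (x - W x) - (y - W y) = (x - y) - (W x - W y).
  by rewrite opprD addrACA -opprD.
rewrite innerDl innerNl -(normsqE inner_norm) subr_ge0.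
rewrite (le_trans (inner_le_norm inner_norm _ _))// expr2.
by rewrite ler_wpM2r// W_nonexpansive.
Qed.

(** [y] is the resolvent of [I - W] at [u] with parameter [1 / sigma];
    equivalently [y = s u + (1 - s) W y] with [s = sigma / (1 + sigma)], the
    implicit Browder-Halpern curve. The form below is the one that can be
    inserted in the monotonicity inequality. *)
Definition resolvent (u : H) (sigma : R) (y : H) : Prop :=
  Q y /\ y - W y = sigma *: (u - y).

Lemma resolvent_exists u sigma : closed Q -> convex_set Q -> Q u ->
  0 < sigma -> exists y, resolvent u sigma y.
Proof.
move=> Qclosed Qconvex Qu sigma0; pose s := sigma / (1 + sigma).
have s0 : 0 < s by rewrite divr_gt0 ?addr_gt0.
have s1 : s < 1 by rewrite ltr_pdivrMr ?addr_gt0// mul1r ltrDr.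
have sE : sigma * (1 - s) = s by rewrite /s; field; lra.
have [|||x y Qx Qy|y [[Qy yE] _]] := @contraction_unique_fixpoint _ _ Q
    (fun z => s *: u + (1 - s) *: W z) (1 - s) _ Qclosed.
- by exists u.
- by move=> x Qx; apply: convex_comb => //; [lra|exact: WQ].
- by lra.
- rewrite opprD addrACA subrr add0r -scalerBr normrZ ger0_norm; last lra.
  by rewrite ler_pM2l ?subr_gt0// W_nonexpansive.
exists y; split=> //.
have -> : y - W y = s *: (u - W y).
  by rewrite {1}yE scalerBl scale1r scalerBr -addrA addrAC subrr sub0r.
have -> : u - y = (1 - s) *: (u - W y).
  by rewrite {1}yE scalerBr [(1 - s) *: u]scalerBl scale1r opprD addrA.
by rewrite scalerA sE.
Qed.

(** Monotonicity between [y] and an arbitrary [x]: approximate fixed points [x]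
    see [u] from [y] under an almost obtuse angle. This quantitative inequality
    takes the place of demiclosedness. *)
Lemma resolvent_inner_le u sigma x y : Q x -> resolvent u sigma y ->
  sigma * '[u - y, x - y] <= `|x - W x| * `|x - y|.
Proof.
move=> Qx [Qy yE]; have := displacement_monotone Qx Qy.
rewrite yE innerDl innerNl innerZl subr_ge0 => /le_trans -> //.
exact: inner_le_norm.
Qed.

(** With [Y = u - y] and [Z = u - z], monotonicity says
    [<sigma Y - tau Z, Y - Z> <= 0]. It forces [|Y| <= |Z|] and then
    [|Y|^2 <= <Y, Z>], which is the claim after expanding [|Y - Z|^2]. *)
Lemma resolvent_dist u sigma tau y z : 0 < tau <= sigma ->
  resolvent u sigma y -> resolvent u tau z ->
  `|z - y| ^+ 2 <= `|z - u| ^+ 2 - `|y - u| ^+ 2.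
Proof.
move=> /andP[tau0 le_ts] [Qy yE] [Qz zE].
have := displacement_monotone Qy Qz; rewrite yE zE.
have -> : y - z = (u - z) - (u - y) by rewrite opprB [RHS]addrC subrKA.
have -> : z - y = (u - y) - (u - z) by rewrite opprB [RHS]addrC subrKA.
rewrite -[z - u]opprB -[y - u]opprB !normrN.
move: (u - y) (u - z) => Y Z; rewrite !innerE (normsqB inner_norm).
rewrite -!(normsqE inner_norm) (innerC Z Y) => mono.
have := inner_le_norm inner_norm Y Z.
have := normr_ge0 Y; have := normr_ge0 Z.
move: mono; move: '[Y, Z] `|Y| `|Z| => c a b mono b0 a0 cab.
have ab : a <= b.
  rewrite leNgt; apply/negP => ba.
  have sum_le : (sigma + tau) * c <= (sigma + tau) * (a * b).
    by rewrite ler_pM2l// addr_gt0// (lt_le_trans tau0).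
  have : 0 < (a - b) * (sigma * a - tau * b).
    rewrite mulr_gt0 ?subr_gt0// (lt_le_trans (y := tau * a)) ?ltr_pM2l//.
    by rewrite ler_wpM2r.
  lra.
have ac : a ^+ 2 <= c.
  rewrite leNgt; apply/negP => ca.
  have : 0 < sigma * (a ^+ 2 - c) by rewrite mulr_gt0 ?subr_gt0//; lra.
  have : 0 <= tau * (b ^+ 2 - c).
    rewrite mulr_ge0 ?(ltW tau0)// subr_ge0 (le_trans (ltW ca))//.
    by rewrite ler_pXn2r.
  lra.
lra.
Qed.

(** The variational inequality satisfied by [y] against a fixed point [p] keeps
    the curve within distance [|u - p|] of [u]. *)
Lemma resolvent_bound u sigma y p : 0 < sigma -> fixed_points Q W p ->
  resolvent u sigma y -> `|y - u| <= `|u - p|.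
Proof.
move=> sigma0 [Qp Wp] uy; have := resolvent_inner_le Qp uy.
rewrite Wp subrr normr0 mul0r pmulr_rle0// => le0.
rewrite distrC; apply: (le_norm_of_sq inner_norm).
by move: le0; rewrite -[p - y](subrKA u) -[p - u]opprB addrC !innerE; lra.
Qed.

(** Along decreasing parameters [|y_n - u|^2] is nondecreasing and bounded, and
    resolvent_dist bounds squared increments of the curve by its increments. *)
Lemma resolvent_cvg u (y : nat -> H) : fixed_points Q W !=set0 ->
  (forall n, resolvent u (harmonic n) (y n)) -> cvgn y.
Proof.
move=> [p Wp] uy; pose phi n := `|y n - u| ^+ 2.
have dist n m : (n <= m)%N -> `|y m - y n| ^+ 2 <= phi m - phi n.
  move=> nm; apply: (@resolvent_dist u (harmonic n) (harmonic m)) => //.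
  by rewrite harmonic_gt0/= lef_pV2 ?posrE// ler_nat.
have phi_bound : has_ubound (range phi).
  exists (`|u - p| ^+ 2) => _ [n _ <-]; rewrite ler_sqr ?nnegrE//.
  exact: (resolvent_bound (harmonic_gt0 n) Wp (uy n)).
have phi_homo : {homo phi : n m / (n <= m)%N >-> n <= m}.
  by move=> n m nm; rewrite -subr_ge0 (le_trans _ (dist _ _ nm))// sqr_ge0.
have phi_le n : phi n <= sup (range phi) by apply: ub_le_sup => //; exists n.
have e0 : sup (range phi) - phi n @[n --> \oo] --> (0 : R).
  rewrite -[X in _ --> X](subrr (sup (range phi))); apply: cvgB.
    exact: cvg_cst.
  exact: nondecreasing_cvgn.
apply: (cvgn_of_sqdist e0) => n m.
wlog nm : n m / (n <= m)%N => [wh|].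
  by have [/wh //|/ltnW/wh] := leqP n m; rewrite distrC [leRHS]addrC.
rewrite distrC (le_trans (dist _ _ nm))//.
by have := phi_le m; lra.
Qed.

Lemma resolvent_lim_fixed u (y : nat -> H) (p : H) : closed Q ->
  fixed_points Q W !=set0 -> (forall n, resolvent u (harmonic n) (y n)) ->
  y n @[n --> \oo] --> p -> fixed_points Q W p.
Proof.
move=> Qclosed [p0 Wp0] uy yp.
have Qp : Q p.
  by apply: (closed_cvg _ Qclosed _ _ yp); near=> n; have [] := uy n.
split=> //; apply/eqP; rewrite eq_sym -subr_eq0 -normr_le0.
have lim0 : 2 * `|p - y n| + harmonic n * `|u - p0| @[n --> \oo]
    --> 2 * 0 + 0 * `|u - p0|.
  apply: cvgD; [apply: cvgMr|apply: cvgMl; exact: cvg_harmonic].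
  rewrite -(normr0 H) -(subrr p); apply: cvg_norm; apply: cvgB => //.
  exact: cvg_cst.
rewrite mulr0 mul0r addr0 in lim0.
apply: (@ler_cvg_to _ (\oo : set_system nat) _ _ (fun=> `|p - W p|)
  (fun n => 2 * `|p - y n| + harmonic n * `|u - p0|) _ 0).
- exact: cvg_cst.
- exact: lim0.
- near=> n; have [Qy yE] := uy n.
  have -> : p - W p = (p - y n) + (y n - W (y n)) + (W (y n) - W p).
    by rewrite !subrKA.
  rewrite (le_trans (ler_normD _ _))//.
  rewrite (le_trans (lerD (ler_normD _ _) (lexx _)))//.
  rewrite yE normrZ gtr0_norm ?harmonic_gt0// distrC.
  have := W_nonexpansive Qy Qp; rewrite [`|y n - p|]distrC.
  have := resolvent_bound (harmonic_gt0 n) Wp0 (uy n).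
  rewrite [`|y n - u|]distrC.
  by move=> /(ler_wpM2l (harmonic_ge0 n)); rewrite distrC; lra.
Unshelve. all: by end_near. Qed.

(** The substitute for weak compactness. The point [p] is the limit of the
    resolvent curve; the second property, with an approximate fixed point [x],
    says that [<u - p, x - p>] is at most [eps] once [x] is within [delta] of
    being fixed, and for exact fixed points it characterizes [p] as a
    projection. *)
Lemma projection_fixed_points u : closed Q -> convex_set Q ->
  fixed_points Q W !=set0 -> Q u ->
  exists p, vi_projection inner (fixed_points Q W) u p /\
    forall M eps, 0 <= M -> 0 < eps -> exists2 delta, 0 < delta &
      forall x, Q x -> `|x - p| <= M -> `|x - W x| <= delta ->
        '[u - p, x - p] <= eps.
Proof.
move=> Qclosed Qconvex W0 Qu.
have /choice[y uy] n : exists y, resolvent u (harmonic n) y.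
  by apply: resolvent_exists => //; exact: harmonic_gt0.
have yp := resolvent_cvg W0 uy; set p := limn y in yp.
have Wp := resolvent_lim_fixed Qclosed W0 uy yp.
suff approx : forall M eps, 0 <= M -> 0 < eps -> exists2 delta, 0 < delta &
    forall x, Q x -> `|x - p| <= M -> `|x - W x| <= delta ->
      '[u - p, x - p] <= eps.
  exists p; split=> //; split=> // x [Qx Wx]; apply/ler_addgt0Pr => e e0.
  have [delta d0 dP] := approx `|x - p| e (normr_ge0 _) e0.
  by rewrite add0r; apply: dP => //; rewrite Wx subrr normr0 ltW.
move=> M eps M0 eps0; pose B := `|u - p| + 1 + M.
have B0 : 0 < B by rewrite ltr_wpDr// ltr_wpDl.
pose eta := Num.min 1 (eps / 2 / B).
have eta0 : 0 < eta by rewrite lt_min ltr01 !divr_gt0.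
have eta1 : eta <= 1 by rewrite ge_min lexx.
have etaB : eta * B <= eps / 2 by rewrite -ler_pdivlMr// ge_min lexx orbT.
(* the index is frozen here: [delta] below scales with [1 / (n + 1)] *)
have [n ny] : exists n, `|p - y n| <= eta.
  by move/cvgrPdist_le : yp => /(_ _ eta0)[n _ nP]; exists n; apply: nP => /=.
have [Qy yE] := uy n.
have h0 : 0 < harmonic n :> R := harmonic_gt0 n.
exists (harmonic n * (eps / 2 / (M + 1))).
  by rewrite mulr_gt0// !divr_gt0// ltr_wpDl.
move=> x Qx xM xW.
have xy : `|x - y n| <= M + 1.
  by rewrite -(subrKA p) (le_trans (ler_normD _ _))// lerD// (le_trans ny).
have uyn : `|u - y n| <= `|u - p| + 1.
  by rewrite -(subrKA p) (le_trans (ler_normD _ _))// lerD// (le_trans ny).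
have main : '[u - y n, x - y n] <= eps / 2.
  rewrite -(ler_pM2l h0) (le_trans (resolvent_inner_le Qx (uy n)))//.
  have -> : eps / 2 = eps / 2 / (M + 1) * (M + 1) by field; lra.
  by rewrite mulrA ler_pM.
(* replacing [p] by [y n] costs at most [eps / 2] by the choice of [eta] *)
have -> : '[u - p, x - p] = '[u - y n, x - y n] + '[u - y n, y n - p]
                            + '[y n - p, x - p].
  by rewrite !innerE; ring.
have := inner_le_norm inner_norm (u - y n) (y n - p).
have := inner_le_norm inner_norm (y n - p) (x - p).
rewrite [`|y n - p|]distrC => le1 le2.
have : `|u - y n| * `|p - y n| <= (`|u - p| + 1) * eta by rewrite ler_pM.
have : `|p - y n| * `|x - p| <= eta * M by rewrite ler_pM.
move: etaB; rewrite /B; lra.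
Qed.

End Resolvent.

(** * The forward-backward step *)

Section ForwardBackward.
Context (R : realType) (H : completeNormedModType R).
Context (inner : {dot H for idfun}) (inner_norm : induces_norm inner).
Context (Q : set H) (nu : R) (nu_gt0 : 0 < nu) (A : H -> H).
Context (A_ism : inverse_strongly_monotone inner Q nu A).

Local Notation "''[' u , v ]" := (inner u v).

(** The map [x |-> P_Q (x - lam A x)] is averaged. With [d = x - y],
    [v = w - z], [g = d - v] and [e = A x - A y], the two projection
    inequalities add up to [<g - lam e, v> >= 0], inverse strong monotonicity is
    [<e, d> >= nu |e|^2], and completing the square in [e], at
    [g = 2 nu e], loses [lam / (2 nu) |g|^2] out of [|g|^2]. The one inequality
    yields both nonexpansiveness and control of the displacement. *)
Lemma forward_backward_averaged lam x y w z : 0 <= lam -> Q x -> Q y ->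
  vi_projection inner Q (x - lam *: A x) w ->
  vi_projection inner Q (y - lam *: A y) z ->
  (1 - lam / (2 * nu)) * `|(x - w) - (y - z)| ^+ 2
    <= `|x - y| ^+ 2 - `|w - z| ^+ 2.
Proof.
move=> lam0 Qx Qy [Qw xw] [Qz yz].
pose g := (x - w) - (y - z); pose v := w - z; pose e := A x - A y.
have dE : x - y = g + v by rewrite /g /v opprB addrACA subrK addrAC subrr sub0r.
have gev : 0 <= '[g, v] - lam * '[e, v].
  have := xw _ Qz; have := yz _ Qw; rewrite /g /v /e !innerE; lra.
have emono : nu * '[e, e] <= '[e, g] + '[e, v].
  by have := A_ism Qx Qy; rewrite -/e (normsqE inner_norm) dE (innerDr g).
(* the completed square *)
have sq : 0 <= lam / (2 * nu) * `|g - (2 * nu) *: e| ^+ 2.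
  by rewrite mulr_ge0 ?sqr_ge0// divr_ge0// ltW// mulr_gt0.
rewrite -/g dE (normsqD inner_norm g v).
have sqE : lam / (2 * nu) * `|g - (2 * nu) *: e| ^+ 2
         = lam / (2 * nu) * `|g| ^+ 2 - 2 * lam * '[e, g]
           + 2 * lam * (nu * '[e, e]).
  rewrite (normsqB inner_norm) normrZ exprMn (normsqE inner_norm e) innerZr.
  rewrite gtr0_norm ?mulr_gt0// (innerC g e); field.
  by rewrite gt_eqF.
have := ler_wpM2l lam0 emono; move: sq; rewrite sqE -/v.
move: (lam / (2 * nu)) => k; lra.
Qed.

(** Shrinking the step from [lam] to [a] changes the projected point by at most
    the displacement at [lam]: [w] is also the projection of
    [w + (a / lam) (x - lam A x - w)], and this point differs from [x - a A x]
    by [(1 - a / lam) (w - x)]. *)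
Lemma forward_backward_rescale a lam x w w' : 0 < a <= lam ->
  vi_projection inner Q (x - lam *: A x) w ->
  vi_projection inner Q (x - a *: A x) w' -> `|w - w'| <= `|x - w|.
Proof.
move=> /andP[a0 al] [Qw xw] xw'.
have l0 : 0 < lam by exact: lt_le_trans al.
pose k := a / lam; have k0 : 0 < k by rewrite divr_gt0.
have k1 : k <= 1 by rewrite ler_pdivrMr// mul1r.
have xwk : vi_projection inner Q (w + k *: (x - lam *: A x - w)) w.
  split=> // y Qy; rewrite [w + _]addrC addrK innerZl.
  by rewrite pmulr_rle0// xw.
rewrite (le_trans (vi_projection_nonexpansive inner_norm xwk xw'))//.
have -> : w + k *: (x - lam *: A x - w) - (x - a *: A x) = (k - 1) *: (x - w).
  rewrite [x - _ - w]addrAC scalerBr scalerA divfK ?gt_eqF//.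
  rewrite opprB addrA [w + (_ - _)]addrA subrK scalerBl scale1r opprB.
  by rewrite [w + _]addrC -addrA.
by rewrite normrZ ler_piMl// ler_norml; lra.
Qed.

Lemma VI_vi_projection lam p : 0 <= lam -> VI_solutions inner A Q p ->
  vi_projection inner Q (p - lam *: A p) p.
Proof.
move=> lam0 [Qp pP]; split=> // y Qy.
by rewrite addrAC subrr sub0r innerNl innerZl oppr_le0 mulr_ge0// pP.
Qed.

Lemma vi_projection_VI lam p : 0 < lam ->
  vi_projection inner Q (p - lam *: A p) p -> VI_solutions inner A Q p.
Proof.
move=> lam0 [Qp pP]; split=> // y /pP.
by rewrite addrAC subrr sub0r innerNl innerZl oppr_le0 pmulr_rge0.
Qed.

End ForwardBackward.

Section ForwardBackwardStep.
Context (R : realType) (H : completeNormedModType R).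
Context (inner : {dot H for idfun}) (inner_norm : induces_norm inner).
Context (Q : set H) (Q0 : Q !=set0) (Qclosed : closed Q).
Context (Qconvex : convex_set Q).
Context (S : H -> H) (SQ : forall x, Q x -> Q (S x)).
Context (S_nonexpansive : nonexpansive Q S).
Context (nu : R) (nu_gt0 : 0 < nu) (A : H -> H).
Context (A_ism : inverse_strongly_monotone inner Q nu A).
Context (a b : R) (a_gt0 : 0 < a) (b_lt : b < 2 * nu).

Local Notation "''[' u , v ]" := (inner u v).
Local Notation P := (metric_projection Q).
Local Notation step lam := (fun x => S (P (x - lam *: A x))).
Local Notation Omega := (fixed_points Q S `&` VI_solutions inner A Q).

Let PP x : vi_projection inner Q x (P x).
Proof. exact: metric_projectionP. Qed.

Let PQ x : Q (P x). Proof. by have [] := PP x. Qed.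

Let ratio lam : a <= lam <= b -> 1 - b / (2 * nu) <= 1 - lam / (2 * nu).
Proof. by move=> /andP[_ lb]; rewrite lerB// ler_pM2r// invr_gt0 mulr_gt0. Qed.

Let lam_ge0 lam : a <= lam <= b -> 0 <= lam.
Proof. by move=> /andP[al _]; rewrite (le_trans _ al)// ltW. Qed.

Let c_gt0 : 0 < 1 - b / (2 * nu).
Proof. by rewrite subr_gt0 ltr_pdivrMr ?mul1r// mulr_gt0. Qed.

Lemma step_stable lam x : Q x -> Q (step lam x).
Proof. by move=> _; exact/SQ/PQ. Qed.

Lemma step_nonexpansive lam : a <= lam <= b -> nonexpansive Q (step lam).
Proof.
move=> lamab x y Qx Qy; rewrite (le_trans (S_nonexpansive (PQ _) (PQ _)))//.
have lam0 : 0 <= lam := lam_ge0 lamab.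
have avg := forward_backward_averaged inner_norm nu_gt0 A_ism lam0 Qx Qy
  (PP _) (PP _).
rewrite -ler_sqr ?nnegrE// -subr_ge0 (le_trans _ avg)//.
by rewrite mulr_ge0 ?sqr_ge0// (le_trans _ (ratio lamab))// ltW.
Qed.

Lemma step_fixed lam p : 0 <= lam -> Omega p -> step lam p = p.
Proof.
move=> lam0 [[Qp Sp] pVI] /=.
by rewrite (vi_projection_inj inner_norm (PP _) (VI_vi_projection lam0 pVI)).
Qed.

(** The averaged inequality against a solution [p], which the projected step
    leaves fixed, bounds the displacement by
    [|x - p|^2 - |w - p|^2 <= 2 |x - p| (|x - p| - |w - p|)], and
    [|w - p| >= |S w - p| >= |x - p| - |x - S w|]. *)
Lemma projection_displacement_le lam x p : a <= lam <= b -> Omega p -> Q x ->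
  (1 - b / (2 * nu)) * `|x - P (x - lam *: A x)| ^+ 2
    <= 2 * `|x - p| * `|x - step lam x|.
Proof.
move=> lamab Op Qx; have lam0 : 0 <= lam := lam_ge0 lamab.
have [[Qp Sp] pVI] := Op; have pP := VI_vi_projection lam0 pVI.
have := forward_backward_averaged inner_norm nu_gt0 A_ism lam0 Qx Qp (PP _) pP.
rewrite subrr subr0; set w := P _ => avg.
have := ler_wpM2r (sqr_ge0 `|x - w|) (ratio lamab) => le1.
rewrite (le_trans le1)// (le_trans avg)// subr_sqr.
have sw : `|S w - p| <= `|w - p| by rewrite -{1}Sp S_nonexpansive//; exact: PQ.
have wp : `|w - p| <= `|x - p|.
  rewrite -ler_sqr ?nnegrE// -subr_ge0 (le_trans _ avg)//.
  by rewrite mulr_ge0 ?sqr_ge0// (le_trans _ (ratio lamab))// ltW.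
have tri : `|x - p| - `|w - p| <= `|x - S w|.
  have := ler_normD (x - S w) (S w - p); rewrite subrKA; lra.
rewrite mulrC ler_pM ?subr_ge0 ?addr_ge0//; lra.
Qed.

Lemma step_displacement_le lam x : a <= lam <= b -> Q x ->
  `|x - step a x| <= `|x - step lam x| + `|x - P (x - lam *: A x)|.
Proof.
move=> /andP[al lb] Qx /=; rewrite -(subrKA (step lam x)).
rewrite (le_trans (ler_normD _ _))// lerD2l.
rewrite (le_trans (S_nonexpansive (PQ _) (PQ _)))//.
apply: (forward_backward_rescale inner_norm (lam := lam) _ (PP _) (PP _)).
by rewrite a_gt0.
Qed.

(** When [x] is fixed by the step, the right-hand side of
    projection_displacement_le vanishes, so [x] is fixed by the projection
    alone, hence also by [S]. *)
Lemma fixed_points_step : a <= b -> Omega !=set0 ->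
  fixed_points Q (step a) = Omega.
Proof.
move=> ab [p Op]; apply/seteqP; split=> [x [Qx xE]|x Ox]; last first.
  by split; [have [[]] := Ox|apply: step_fixed => //; exact: ltW].
have aab : a <= a <= b by rewrite lexx.
have := projection_displacement_le aab Op Qx.
rewrite xE subrr normr0 mulr0 pmulr_rle0// => le0.
have xP : x = P (x - a *: A x).
  apply/eqP; rewrite -subr_eq0 -normr_eq0 -sqrf_eq0 eq_le le0 sqr_ge0//.
split; first by split=> //; rewrite {1}xP.
by apply: (vi_projection_VI (lam := a)) => //; rewrite {3}xP.
Qed.

(** On bounded sets, almost fixed for the step [lam] implies almost fixed for
    the step [a], uniformly in [lam] between [a] and [b]. This is what lets a
    single map stand for the whole family when the step varies with [t]. *)
Lemma step_asymptotically_regular p M delta : Omega p -> 0 <= M -> 0 < delta ->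
  exists2 eta, 0 < eta & forall lam x, a <= lam <= b -> Q x ->
    `|x - p| <= M -> `|x - step lam x| <= eta -> `|x - step a x| <= delta.
Proof.
move=> Op M0 d0; pose c := 1 - b / (2 * nu).
have M10 : 0 < M + 1 by rewrite ltr_wpDl.
(* makes both [|x - step lam x|] and the displacement at most [delta / 2] *)
pose eta := Num.min (delta / 2) (c * (delta / 2) ^+ 2 / (2 * (M + 1))).
have eta0 : 0 < eta.
  by rewrite lt_min !divr_gt0 ?mulr_gt0 ?exprn_gt0 ?divr_gt0// mulr_gt0.
have eta1 : eta <= delta / 2 by rewrite ge_min lexx.
have eta2 : eta * (2 * (M + 1)) <= c * (delta / 2) ^+ 2.
  by rewrite -ler_pdivlMr ?mulr_gt0// ge_min lexx orbT.
exists eta => // lam x lamab Qx xM xeta.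
rewrite (le_trans (step_displacement_le lamab Qx))// [leRHS]splitr lerD//.
  exact: le_trans eta1.
rewrite -ler_sqr ?nnegrE//; last by rewrite ltW// divr_gt0.
rewrite -(ler_pM2l c_gt0).
rewrite (le_trans (projection_displacement_le lamab Op Qx))//.
rewrite (le_trans _ eta2)//.
have := ler_pM (normr_ge0 _) (normr_ge0 _) xM xeta.
have : 0 <= eta by exact: ltW.
by rewrite -mulrA; lra.
Qed.

End ForwardBackwardStep.

(** Write [x - q] as [t (v - u) + t (u - q) + (1 - t) (s - q)] and take the
    inner product with [x - q]; the factor [t] cancels. It is applied with
    [v = f x] and [u = f q]. *)
Lemma viscosity_inequality (R : realType) (H : completeNormedModType R)
    (inner : {dot H for idfun}) (inner_norm : induces_norm inner)
    (rho t : R) (x q u v s : H) :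
  0 < t <= 1 -> x = t *: v + (1 - t) *: s ->
  `|s - q| <= `|x - q| -> `|v - u| <= rho * `|x - q| ->
  (1 - rho) * `|x - q| ^+ 2 <= inner (u - q) (x - q).
Proof.
move=> /andP[t0 t1] xE sx vu; rewrite -(ler_pM2l t0).
have dE : x - q = t *: (v - u) + t *: (u - q) + (1 - t) *: (s - q).
  rewrite -scalerDr subrKA {1}xE !scalerBr addrACA -opprD.
  by rewrite -scalerDl [t + _]addrC subrK scale1r.
have : `|x - q| ^+ 2 = t * inner (v - u) (x - q) + t * inner (u - q) (x - q)
     + (1 - t) * inner (s - q) (x - q).
  rewrite (normsqE inner_norm) {1}dE (innerDl (_ + _)) (innerDl (t *: _)).
  by rewrite !innerZl.
have := ler_wpM2l (ltW t0) (inner_le_norm inner_norm (v - u) (x - q)).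
have t1' : 0 <= 1 - t by lra.
have := ler_wpM2l t1' (inner_le_norm inner_norm (s - q) (x - q)).
have := ler_wpM2l (ltW t0) (ler_wpM2r (normr_ge0 (x - q)) vu).
have := ler_wpM2l t1' (ler_wpM2r (normr_ge0 (x - q)) sx).
rewrite !expr2; lra.
Qed.

(** * Viscosity approximation *)

Lemma VP_solution_unique (R : realType) (H : completeNormedModType R)
    (inner : {dot H for idfun}) (inner_norm : induces_norm inner)
    (Omega : set H) (f : H -> H) (rho : R) (q q' : H) : rho < 1 ->
  `|f q - f q'| <= rho * `|q - q'| ->
  VP_solution inner Omega f q -> VP_solution inner Omega f q' -> q = q'.
Proof.
move=> rho1 fqq' qP q'P; apply/eqP; rewrite -subr_eq0 -normr_le0.
have := vi_projection_nonexpansive inner_norm qP q'P.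
by move=> /le_trans /(_ fqq'); nra.
Qed.

(** Composing [f] with the projection onto [Omega] gives a contraction of [Q],
    whose fixed point solves (VP). *)
Lemma VP_solution_exists (R : realType) (H : completeNormedModType R)
    (inner : {dot H for idfun}) (inner_norm : induces_norm inner)
    (Q Omega : set H) (f : H -> H) (rho : R) :
  Q !=set0 -> closed Q -> Omega `<=` Q -> (forall x, Q x -> Q (f x)) ->
  0 <= rho < 1 ->
  (forall x y, Q x -> Q y -> `|f x - f y| <= rho * `|x - y|) ->
  (forall u, Q u -> exists p, vi_projection inner Omega u p) ->
  exists q, VP_solution inner Omega f q.
Proof.
move=> Q0 Qclosed OQ fQ rho01 f_rho proj.
have /choice[g gP] u : exists p, Q u -> vi_projection inner Omega u p.
  have [Qu|nQu] := pselect (Q u); last by exists u.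
  by have [p uP] := proj _ Qu; exists p.
have [|x y Qx Qy|q [[Qq qE] _]] :=
  @contraction_unique_fixpoint _ _ Q (g \o f) rho Q0 Qclosed _ rho01.
- by move=> x /fQ/gP[/OQ].
- apply: le_trans (f_rho _ _ Qx Qy).
  exact: (vi_projection_nonexpansive inner_norm (gP _ (fQ _ Qx))
    (gP _ (fQ _ Qy))).
by exists q; rewrite /VP_solution {1 3 4}qE; exact: (gP _ (fQ _ Qq)).
Qed.

Theorem theorem3p1 (R : realType) (H : completeNormedModType R)
    (inner : {dot H for idfun}) (inner_norm : induces_norm inner)
    (Q : set H) (Q0 : Q !=set0) (Qclosed : closed Q)
    (Qconvex : convex_set Q)
    (S : {fun Q >-> Q}) (S_nonexpansive : nonexpansive Q S)
    (nu : R) (nu_gt0 : 0 < nu)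
    (A : H -> H) (A_ism : inverse_strongly_monotone inner Q nu A)
    (rho : {nonneg R}) (f : {fun Q >-> Q}) (f_contraction : contraction rho f)
    (Omega : set H)
    (OmegaE : Omega = fixed_points Q S `&` VI_solutions inner A Q)
    (Omega0 : Omega !=set0)
    (a b : R) (a_gt0 : 0 < a) (lt_ab : a < b) (b_lt : b < 2 * nu)
    (lambda : {fun `]0, 1[%classic >-> `[a, b]%classic}) :
  (forall t : R, 0 < t < 1 ->
    exists! x : H, implicit_solution Q S A f lambda t x) /\
  (exists q : H, unique (VP_solution inner Omega f) q /\
    forall x : R -> H,
      (forall t : R, 0 < t < 1 -> implicit_solution Q S A f lambda t (x t)) ->
      x t @[t --> 0^'+] --> q).
Proof.
have [rho1 f_lip] := f_contraction.
have rho0 : 0 <= rho%:num by [].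
have SQ x : Q x -> Q (S x) by move=> Qx; exact: funS.
have fQ x : Q x -> Q (f x) by move=> Qx; exact: funS.
have f_rho x y : Q x -> Q y -> `|f x - f y| <= rho%:num * `|x - y|.
  by move=> Qx Qy; exact: (f_lip (x, y)).
have lamab t : 0 < t < 1 -> a <= lambda t <= b.
  move=> t01; have : `[a, b]%classic (lambda t).
    by apply: funS; rewrite /= in_itv.
  by rewrite /= in_itv.
have ab := ltW lt_ab.
pose step lam x := S (metric_projection Q (x - lam *: A x)).
have stepQ lam x : Q x -> Q (step lam x).
  exact: (step_stable inner_norm Q0 Qclosed Qconvex SQ).
have step_ne lam : a <= lam <= b -> nonexpansive Q (step lam).
  exact: (step_nonexpansive inner_norm Q0 Qclosed Qconvex S_nonexpansive nu_gt0
    A_ism a_gt0 b_lt).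
have aab : a <= a <= b by rewrite lexx.
have fixW : fixed_points Q (step a) = Omega.
  rewrite OmegaE; rewrite OmegaE in Omega0.
  exact: (fixed_points_step inner_norm Q0 Qclosed Qconvex S_nonexpansive nu_gt0
    A_ism a_gt0 b_lt ab Omega0).
have proj u : Q u -> exists p, vi_projection inner Omega u p /\
    forall M eps, 0 <= M -> 0 < eps -> exists2 delta, 0 < delta &
      forall x, Q x -> `|x - p| <= M -> `|x - step a x| <= delta ->
        inner (u - p) (x - p) <= eps.
  rewrite -fixW; rewrite -fixW in Omega0 => Qu.
  exact: (projection_fixed_points inner_norm (stepQ a) (step_ne a aab)).
have OmegaQ : Omega `<=` Q by rewrite OmegaE => x [[]].
split=> [t t01|].
  have /andP[t0 t1] := t01.
  apply: (contraction_unique_fixpoint Q0 Qclosed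
    (k := t * rho%:num + (1 - t))) => [x Qx||x y Qx Qy].
  - by apply: convex_comb => //; [rewrite !ltW|exact: fQ|exact: stepQ].
  - by nra.
  - rewrite opprD addrACA -!scalerBr (le_trans (ler_normD _ _))// !normrZ.
    rewrite gtr0_norm// gtr0_norm ?subr_gt0// [leRHS]mulrDl -mulrA.
    by rewrite lerD// ler_pM2l ?subr_gt0// ?f_rho// step_ne// lamab.
have [q qP] : exists q, VP_solution inner Omega f q.
  apply: (VP_solution_exists inner_norm (rho := rho%:num) Q0 Qclosed OmegaQ fQ)
    => //.
    by rewrite rho0.
  by move=> u /proj[p [up _]]; exists p.
have Qq := OmegaQ _ qP.1.
exists q; split.
  split=> // q' q'P; apply: (VP_solution_unique inner_norm rho1 _ qP q'P).
  by apply: f_rho => //; exact: (OmegaQ _ q'P.1).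
move=> x xP; apply/cvgrPdist_le => eps eps0.
pose M := `|f q - q| / (1 - rho%:num).
have rho1' : 0 < 1 - rho%:num by rewrite subr_gt0.
have M0 : 0 <= M by rewrite divr_ge0// ltW.
have M10 : 0 < M + 1 by rewrite ltr_wpDl.
have [q' [qP' approx]] := proj _ (fQ _ Qq).
rewrite -(vi_projection_inj inner_norm qP qP') in approx.
have [|delta d0 dP] := approx M ((1 - rho%:num) * eps ^+ 2) M0.
  by rewrite mulr_gt0// exprn_gt0.
have Oq := qP.1; rewrite OmegaE in Oq.
have [eta eta0 etaP] := step_asymptotically_regular inner_norm Q0 Qclosed
  Qconvex S_nonexpansive nu_gt0 A_ism a_gt0 b_lt Oq M0 d0.
have small : 0 < eta / (2 * (M + 1)) by rewrite divr_gt0// mulr_gt0.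
near=> t.
have t0 : 0 < t by near: t; exact: nbhs_right_gt.
have t1 : t < 1 by near: t; exact: nbhs_right_lt.
have t01 : 0 < t < 1 by rewrite t0.
have [Qx xE] := xP _ t01; rewrite -/(step _ _) in xE.
have sx : `|step (lambda t) (x t) - q| <= `|x t - q|.
  rewrite -{1}(step_fixed inner_norm Q0 Qclosed Qconvex
    (lam := lambda t) _ Oq); first by apply: step_ne => //; exact: lamab.
  by have /andP[al _] := lamab _ t01; rewrite (le_trans _ al)// ltW.
have fx := f_rho _ _ Qx Qq.
have t01' : 0 < t <= 1 by rewrite t0 ltW.
have visc := viscosity_inequality inner_norm t01' xE sx fx.
(* Cauchy-Schwarz in the viscosity inequality bounds the whole family *)
have xM : `|x t - q| <= M.
  rewrite ler_pdivlMr//; have := inner_le_norm inner_norm (f q - q) (x t - q).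
  have [->|xq] := eqVneq (x t - q) 0; first by rewrite normr0 mul0r.
  move=> /(le_trans visc); rewrite expr2 mulrA ler_pM2r ?normr_gt0//.
  by rewrite mulrC.
(* the defining equation makes this displacement at most [2 (M + 1) t] *)
have xstep : `|x t - step (lambda t) (x t)| <= eta.
  have -> : x t - step (lambda t) (x t)
          = t *: (f (x t) - step (lambda t) (x t)).
    rewrite {1}xE scalerBl scale1r scalerBr -addrA.
    by rewrite [step _ _ - _ - _]addrAC subrr sub0r.
  have fxs : `|f (x t) - step (lambda t) (x t)| <= 2 * (M + 1).
    have -> : f (x t) - step (lambda t) (x t)
      = (f (x t) - f q) + (f q - q) + (q - step (lambda t) (x t)).
      by rewrite !subrKA.
    rewrite (le_trans (ler_normD _ _))//.
    rewrite (le_trans (lerD (ler_normD _ _) (lexx _)))//.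
    rewrite [`|q - _|]distrC.
    have fqE : `|f q - q| = (1 - rho%:num) * M by rewrite mulrC divfK// gt_eqF.
    rewrite fqE; have := ler_wpM2l rho0 xM; lra.
  rewrite normrZ gtr0_norm//.
  rewrite (le_trans (ler_wpM2l (ltW t0) fxs))// -ler_pdivlMr ?mulr_gt0//.
  by near: t; exact: nbhs_right_le.
rewrite distrC -ler_sqr ?nnegrE//; last exact: ltW.
rewrite -(ler_pM2l rho1') (le_trans visc)//.
by apply: dP => //; apply: etaP xstep => //; exact: lamab.
Unshelve. all: by end_near. Qed.
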